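(* Let $R$ be a refinement ring with the following property: for all finitely generated projective $R$-modules $A,B$ with $B$ a generator, $2R\oplus A\cong R\oplus B$ implies $R\oplus A\cong B$. Then every regular square matrix over $R$ admits a diagonal reduction.
   Context: Modules are right modules. A ring $R$ is a refinement ring if the monoid $V(R)$ of isomorphism classes of finitely generated projective $R$-modules (under direct sum) has the refinement property: whenever $x_1+x_2=y_1+y_2$ in $V(R)$, there exist $z_{ij}\in V(R)$ with $x_i=z_{i1}+z_{i2}$ and $y_j=z_{1j}+z_{2j}$. $2R=R\oplus R$. A matrix $f\in M_{m\times n}(R)$ is regular if there is $g\in M_{n\times m}(R)$ with $fgf=f$. A matrix $A$ admits a diagonal reduction if there exist invertible matrices $P,Q$ with $PAQ$ diagonal (all entries $a_{ij}$ with $i\ne j$ equal to $0$). *)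

(* Defs.v *)
(* Finitely generated projective right R-modules are encoded
   by idempotent square matrices: the idempotent e : 'M_n represents the
   module e R^n (column vectors, right R-action), and V(R) is the set of
   such idempotents up to module isomorphism. *)
From HB Require Import structures.
From mathcomp Require Import all_boot all_order all_algebra.
Set Implicit Arguments. Unset Strict Implicit. Unset Printing Implicit Defensive.
Import GRing.Theory.
Local Open Scope ring_scope.

Section FGP.
Variable R : pzRingType.

Record fgp := FGP { fgp_dim : nat; fgp_idem : 'M[R]_fgp_dim }.

Definition fgp_ok (P : fgp) : Prop :=
  fgp_idem P *m fgp_idem P = fgp_idem P.

(* module isomorphism e R^n ~= f R^m : mutually inverse homomorphisms
   x : eR^n -> fR^m and y : fR^m -> eR^n (given by left multiplication) *)
Definition fgp_iso (P Q : fgp) : Prop :=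
  exists (x : 'M[R]_(fgp_dim Q, fgp_dim P)) (y : 'M[R]_(fgp_dim P, fgp_dim Q)),
    [/\ x = fgp_idem Q *m x *m fgp_idem P,
        y = fgp_idem P *m y *m fgp_idem Q,
        y *m x = fgp_idem P & x *m y = fgp_idem Q].

Definition fgp_sum (P Q : fgp) : fgp :=
  @FGP (fgp_dim P + fgp_dim Q) (block_mx (fgp_idem P) 0 0 (fgp_idem Q)).

Definition fgp_free (n : nat) : fgp := @FGP n 1%:M.

(* P is a generator of Mod-R: some finite direct sum P^k maps onto R.
   A homomorphism P^k -> R is a family of homomorphisms x_i : P -> R
   (row vectors with x_i = x_i e); it is onto iff 1 lies in its image,
   i.e. 1 = sum_i x_i y_i for some y_i in P (y_i = e y_i). *)
Definition fgp_generator (P : fgp) : Prop :=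
  exists (k : nat) (x : 'I_k -> 'rV[R]_(fgp_dim P)) (y : 'I_k -> 'cV[R]_(fgp_dim P)),
    [/\ (forall i, x i = x i *m fgp_idem P),
        (forall i, y i = fgp_idem P *m y i) &
        \sum_(i < k) x i *m y i = 1%:M].

Definition refinement_ring : Prop :=
  forall x1 x2 y1 y2 : fgp,
    fgp_ok x1 -> fgp_ok x2 -> fgp_ok y1 -> fgp_ok y2 ->
    fgp_iso (fgp_sum x1 x2) (fgp_sum y1 y2) ->
    exists z11 z12 z21 z22 : fgp,
      [/\ fgp_ok z11, fgp_ok z12, fgp_ok z21 & fgp_ok z22] /\
      [/\ fgp_iso x1 (fgp_sum z11 z12), fgp_iso x2 (fgp_sum z21 z22),
          fgp_iso y1 (fgp_sum z11 z21) & fgp_iso y2 (fgp_sum z12 z22)].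

Definition regular_mx m n (f : 'M[R]_(m, n)) : Prop :=
  exists g : 'M[R]_(n, m), f *m g *m f = f.

Definition invertible_mx n (P : 'M[R]_n) : Prop :=
  exists P' : 'M[R]_n, P *m P' = 1%:M /\ P' *m P = 1%:M.

Definition diag_reducible m n (A : 'M[R]_(m, n)) : Prop :=
  exists (P : 'M[R]_m) (Q : 'M[R]_n),
    [/\ invertible_mx P, invertible_mx Q & is_diag_mx (P *m A *m Q)].

End FGP.

(* Main.v *)
(* Write u for the class of R in V(R).  A regular n x n matrix with kernel k,
   image i and cokernel c satisfies k + i = c + i = n u, and it is determined
   up to equivalence by the isomorphism types of k, i and c.  Hence it suffices
   to split off, when n >= 2, a common summand e of k and c and a summand i1
   of i with e + i1 = u whose complements still satisfy
   k' + i' = c' + i' = (n-1) u.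
   Refining k + i = u + (n-1) u gives k = k1 + k2, i = q + j with k1 + q = u and
   k2 + j = (n-1) u, and an exchange makes q a summand of j, so that c + j is
   an order unit.  The hypothesis then cancels q from k + (q + j) = c + (q + j),
   and the refinement of k + j = c + j provides the required e: the part of
   k1 not common with c is a summand of j, hence can be taken from i instead. *)
Require Import Defs.
From HB Require Import structures.
From mathcomp Require Import all_boot all_order all_algebra.
From Stdlib Require Import Setoid Morphisms.
Set Implicit Arguments. Unset Strict Implicit. Unset Printing Implicit Defensive.
Import GRing.Theory.
Local Open Scope ring_scope.

Section Modules.
Variable R : pzRingType.
Implicit Types P Q S : fgp R.

(** * Isomorphisms and direct sums of modules given by idempotents *)

(** Compressing [x] and [y] to the corners cut out by the two idempotents keeps them mutually
    inverse, so witnesses need not be compressed beforehand. *)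
Lemma fgp_isoI P Q (x : 'M[R]_(fgp_dim Q, fgp_dim P))
    (y : 'M[R]_(fgp_dim P, fgp_dim Q)) :
  fgp_ok P -> fgp_ok Q -> y *m x = fgp_idem P -> x *m y = fgp_idem Q ->
  fgp_iso P Q.
Proof.
rewrite /fgp_ok => Pok Qok yx xy.
exists (fgp_idem Q *m x *m fgp_idem P), (fgp_idem P *m y *m fgp_idem Q).
split.
- by rewrite !mulmxA Qok -!mulmxA Pok.
- by rewrite !mulmxA Pok -!mulmxA Qok.
- rewrite -!mulmxA [fgp_idem Q *m (fgp_idem Q *m _)]mulmxA Qok -{1}xy.
  by rewrite !mulmxA -(mulmxA _ y x) yx -(mulmxA _ y x) yx !Pok.
- rewrite -!mulmxA [fgp_idem P *m (fgp_idem P *m _)]mulmxA Pok -{1}yx.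
  by rewrite !mulmxA -(mulmxA _ x y) xy -(mulmxA _ x y) xy !Qok.
Qed.

Lemma fgp_isoE P Q : fgp_ok P -> fgp_ok Q -> fgp_iso P Q ->
  exists (x : 'M[R]_(fgp_dim Q, fgp_dim P)) (y : 'M[R]_(fgp_dim P, fgp_dim Q)),
    [/\ fgp_idem Q *m x = x, x *m fgp_idem P = x, fgp_idem P *m y = y,
        y *m fgp_idem Q = y & y *m x = fgp_idem P /\ x *m y = fgp_idem Q].
Proof.
rewrite /fgp_ok => Pok Qok [x [y [hx hy yx xy]]]; exists x, y; split=> //.
- by rewrite hx !mulmxA Qok.
- by rewrite hx -!mulmxA Pok.
- by rewrite hy !mulmxA Pok.
- by rewrite hy -!mulmxA Qok.
Qed.

Lemma fgp_iso_refl P : fgp_ok P -> fgp_iso P P.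
Proof. by move=> Pok; apply: (fgp_isoI (x := fgp_idem P) (y := fgp_idem P)). Qed.

Lemma fgp_iso_sym P Q : fgp_iso P Q -> fgp_iso Q P.
Proof. by case=> x [y [hx hy yx xy]]; exists y, x. Qed.

Lemma fgp_iso_trans P Q S :
  fgp_ok P -> fgp_ok Q -> fgp_ok S -> fgp_iso P Q -> fgp_iso Q S -> fgp_iso P S.
Proof.
move=> Pok Qok Sok [x [y [hx hy yx xy]]] [z [t [hz ht tz zt]]].
apply: (fgp_isoI (x := z *m x) (y := y *m t)) => //.
- by rewrite -mulmxA (mulmxA t) tz mulmxA [in LHS]hy -(mulmxA _ _ (fgp_idem Q)) Qok -hy.
- by rewrite -mulmxA (mulmxA x) xy mulmxA [in LHS]hz -(mulmxA _ _ (fgp_idem Q)) Qok -hz.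
Qed.

Lemma fgp_sum_ok P Q : fgp_ok P -> fgp_ok Q -> fgp_ok (fgp_sum P Q).
Proof.
rewrite /fgp_ok /= => Pok Qok.
by rewrite mulmx_block !mul0mx !mulmx0 Pok Qok !addr0 add0r.
Qed.

Lemma fgp_free_ok n : fgp_ok (fgp_free R n).
Proof. by rewrite /fgp_ok /= mul1mx. Qed.

Lemma fgp_sum_iso P P' Q Q' :
  fgp_iso P P' -> fgp_iso Q Q' -> fgp_iso (fgp_sum P Q) (fgp_sum P' Q').
Proof.
move=> [x [y [hx hy yx xy]]] [z [t [hz ht tz zt]]].
exists (block_mx x 0 0 z), (block_mx y 0 0 t); split => /=;
  by rewrite !mulmx_block !(mul0mx, mulmx0, addr0, add0r)
     -?hx -?hy -?hz -?ht ?yx ?xy ?tz ?zt.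
Qed.

Lemma fgp_sumC P Q :
  fgp_ok P -> fgp_ok Q -> fgp_iso (fgp_sum P Q) (fgp_sum Q P).
Proof.
move=> Pok Qok.
apply: (@fgp_isoI (fgp_sum P Q) (fgp_sum Q P)
  (block_mx 0 (fgp_idem Q) (fgp_idem P) 0)
  (block_mx 0 (fgp_idem P) (fgp_idem Q) 0));
  by [apply: fgp_sum_ok | rewrite /= mulmx_block !(mul0mx, mulmx0, addr0, add0r) Pok Qok].
Qed.

Lemma fgp_sumA P Q S : fgp_ok P -> fgp_ok Q -> fgp_ok S ->
  fgp_iso (fgp_sum P (fgp_sum Q S)) (fgp_sum (fgp_sum P Q) S).
Proof.
move=> Pok Qok Sok; apply: fgp_iso_sym.
apply: (@fgp_isoI (fgp_sum (fgp_sum P Q) S) (fgp_sum P (fgp_sum Q S))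
  (block_mx (row_mx (fgp_idem P) 0) 0
                 (block_mx 0 (fgp_idem Q) 0 0) (col_mx 0 (fgp_idem S)))
  (block_mx (col_mx (fgp_idem P) 0) (block_mx 0 0 (fgp_idem Q) 0)
                 0 (row_mx 0 (fgp_idem S)))).
- by do 2?apply: fgp_sum_ok.
- by do 2?apply: fgp_sum_ok.
- rewrite /= !(mulmx_block, mul_col_row, mul_row_col, mul_block_col, mul_row_block).
  rewrite !(col_mx0, row_mx0, mul0mx, mulmx0, addr0, add0r) Pok Qok Sok.
  by rewrite add_block_mx !(addr0, add0r).
- rewrite /= !(mulmx_block, mul_col_row, mul_row_col, mul_block_col, mul_row_block).
  rewrite !(col_mx0, row_mx0, mul0mx, mulmx0, addr0, add0r) Pok Qok Sok.
  by rewrite add_block_mx !(addr0, add0r).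
Qed.

Lemma fgp_freeD m n : fgp_free R (m + n) = fgp_sum (fgp_free R m) (fgp_free R n).
Proof. by rewrite /fgp_sum /fgp_free /= -scalar_mx_block. Qed.

(** The blocks of the isomorphism are the inclusions [xP], [xQ] and the projections [yP], [yQ] of an
    internal decomposition of R^n. *)
Lemma fgp_sum_freeP P Q n : fgp_iso (fgp_sum P Q) (fgp_free R n) ->
  exists (xP : 'M[R]_(n, fgp_dim P)) (yP : 'M[R]_(fgp_dim P, n))
         (xQ : 'M[R]_(n, fgp_dim Q)) (yQ : 'M[R]_(fgp_dim Q, n)),
    [/\ xP *m fgp_idem P = xP, xQ *m fgp_idem Q = xQ,
        yP *m xP = fgp_idem P, yQ *m xQ = fgp_idem Q
      & xP *m yP + xQ *m yQ = 1%:M].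
Proof.
case=> x [y [/= hx hy yx xy]].
move: hx hy yx xy; rewrite -(hsubmxK x) -(vsubmxK y).
move: (lsubmx x) (rsubmx x) (usubmx y) (dsubmx y) => xP xQ yP yQ.
rewrite mul1mx mul_row_block !mulmx0 addr0 add0r => /eq_row_mx[hP hQ] _.
rewrite mul_col_row mul_row_col => /eq_block_mx[? ? ? ?] ?.
by exists xP, yP, xQ, yQ.
Qed.

(** * Regular matrices up to equivalence, through kernel, image and cokernel *)

Section Matrices.
Variable n : nat.
Implicit Types A g D h : 'M[R]_n.

(* k, i and c are the kernel, image and cokernel of D. *)
Definition splits D h (k i c : fgp R) :=
  [/\ D *m h *m D = D, fgp_iso (FGP (D *m h)) i,
      fgp_iso (FGP (1%:M - D *m h)) c & fgp_iso (FGP (1%:M - h *m D)) k].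

Lemma fgp_iso_split P (x : 'M[R]_(n, fgp_dim P)) (y : 'M[R]_(fgp_dim P, n)) :
  fgp_ok P -> y *m x = fgp_idem P -> x *m fgp_idem P = x ->
  fgp_iso (FGP (x *m y)) P.
Proof.
move=> Pok yx xP; apply: (@fgp_isoI (FGP (x *m y)) P y x) => //.
by rewrite /fgp_ok /= mulmxA -(mulmxA x) yx xP.
Qed.

(** Take two decompositions of R^n, one containing [k] and [i], the other [c] and [i]. The matrix
    [D] kills [k] and carries the first copy of [i] onto the second; [h] carries it back and kills
    [c]. *)
Lemma splits_exists k i c : fgp_ok k -> fgp_ok i -> fgp_ok c ->
  fgp_iso (fgp_sum k i) (fgp_free R n) -> fgp_iso (fgp_sum c i) (fgp_free R n) ->
  exists D h, splits D h k i c.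
Proof.
move=> kok iok cok.
move=> /fgp_sum_freeP[xk [yk [xi [yi [hk hi yxk yxi e1]]]]].
move=> /fgp_sum_freeP[xc [yc [xj [yj [hc hj yxc yxj e2]]]]].
exists (xj *m yi), (xi *m yj).
have Dh : xj *m yi *m (xi *m yj) = xj *m yj.
  by rewrite mulmxA -(mulmxA xj) yxi hj.
have hD : xi *m yj *m (xj *m yi) = xi *m yi.
  by rewrite mulmxA -(mulmxA xi) yxj hi.
split.
- by rewrite Dh mulmxA -(mulmxA xj) yxj hj.
- by rewrite Dh; apply: fgp_iso_split.
- by rewrite Dh -e2 addrK; apply: fgp_iso_split.
- by rewrite hD -e1 addrK; apply: fgp_iso_split.
Qed.

Lemma regular_ok A g : A *m g *m A = A ->
  [/\ fgp_ok (FGP (A *m g)), fgp_ok (FGP (1%:M - A *m g))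
    & fgp_ok (FGP (1%:M - g *m A))].
Proof.
move=> AgA; rewrite /fgp_ok /=.
have e1 : A *m g *m (A *m g) = A *m g by rewrite mulmxA AgA.
have e2 : g *m A *m (g *m A) = g *m A by rewrite -mulmxA (mulmxA A) AgA.
split=> //.
- by rewrite mulmxBl mul1mx mulmxBr mulmx1 e1 subrr subr0.
- by rewrite mulmxBl mul1mx mulmxBr mulmx1 e2 subrr subr0.
Qed.

(** R^n is image plus cokernel on the target side and kernel plus a copy of the image on the source
    side. Gluing the given isomorphisms summand by summand yields [P] and [Q]. *)
Lemma regular_equivalent A g D h : A *m g *m A = A -> D *m h *m D = D ->
  fgp_iso (FGP (A *m g)) (FGP (D *m h)) ->
  fgp_iso (FGP (1%:M - A *m g)) (FGP (1%:M - D *m h)) ->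
  fgp_iso (FGP (1%:M - g *m A)) (FGP (1%:M - h *m D)) ->
  exists P Q : 'M[R]_n, [/\ invertible_mx P, invertible_mx Q & P *m A *m Q = D].
Proof.
move=> AgA DhD; have [ok1 ok2 ok3] := regular_ok AgA.
have [ok4 ok5 ok6] := regular_ok DhD.
move=> /(fgp_isoE ok1 ok4)[x [y [/= fx xe ey yf [yx xy]]]].
move=> /(fgp_isoE ok2 ok5)[x' [y' [/= fx' xe' ey' yf' [yx' xy']]]].
move=> /(fgp_isoE ok3 ok6)[v [w [/= fv ve ew wf [wv vw]]]].
have Agy' : A *m g *m y' = 0.
  by rewrite -ey' mulmxA mulmxBr mulmx1 mulmxA AgA subrr mul0mx.
have xAg' : x' *m (A *m g) = 0.
  by rewrite -xe' -mulmxA mulmxBl mul1mx mulmxA AgA subrr mulmx0.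
have Dhx' : D *m h *m x' = 0.
  by rewrite -fx' mulmxA mulmxBr mulmx1 mulmxA DhD subrr mul0mx.
have yDh' : y' *m (D *m h) = 0.
  by rewrite -yf' -mulmxA mulmxBl mul1mx mulmxA DhD subrr mulmx0.
have Aw : A *m w = 0.
  by rewrite -ew mulmxA mulmxBr mulmx1 mulmxA AgA subrr mul0mx.
have Dv : D *m v = 0.
  by rewrite -fv mulmxA mulmxBr mulmx1 mulmxA DhD subrr mul0mx.
have whD : w *m (h *m D) = 0.
  by rewrite -wf -mulmxA mulmxBl mul1mx -!mulmxA (mulmxA D) DhD subrr mulmx0.
have vgA : v *m (g *m A) = 0.
  by rewrite -ve -mulmxA mulmxBl mul1mx -!mulmxA (mulmxA A) AgA subrr mulmx0.
(* On the source side the isomorphism of images is transported: [D] sends the complement of its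
   kernel to its image, [y] passes to the image of [A], and [g] lifts back. The kernels are matched
   by [w]. *)
exists (x + x'), (g *m y *m D + w); split.
- exists (y + y'); split; rewrite mulmxDl !mulmxDr.
  + have -> : x *m y' = 0 by rewrite -xe -mulmxA Agy' mulmx0.
    have -> : x' *m y = 0 by rewrite -ey mulmxA xAg' mul0mx.
    by rewrite xy xy' addr0 add0r addrC subrK.
  + have -> : y *m x' = 0 by rewrite -yf -mulmxA Dhx' mulmx0.
    have -> : y' *m x = 0 by rewrite -fx mulmxA yDh' mul0mx.
    by rewrite yx yx' addr0 add0r addrC subrK.
- exists (h *m x *m A + v); split; rewrite mulmxDl !mulmxDr ?wv ?vw.
  + have -> : g *m y *m D *m (h *m x *m A) = g *m A.
      rewrite !mulmxA -(mulmxA _ D h) -(mulmxA g y) yf -(mulmxA g y) yx.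
      by rewrite -!mulmxA (mulmxA A) AgA.
    have -> : w *m (h *m x *m A) = 0.
      by rewrite -fx !mulmxA -(mulmxA w h D) whD !mul0mx.
    by rewrite -(mulmxA _ D) Dv mulmx0 addr0 add0r addrC subrK.
  + have -> : h *m x *m A *m (g *m y *m D) = h *m D.
      rewrite !mulmxA -(mulmxA _ A g) -(mulmxA h x) xe -(mulmxA h x) xy.
      by rewrite -!mulmxA (mulmxA D) DhD.
    have -> : v *m (g *m y *m D) = 0.
      by rewrite -ey !mulmxA -(mulmxA v g A) vgA !mul0mx.
    by rewrite -(mulmxA _ A) Aw mulmx0 addr0 add0r addrC subrK.
- rewrite -mulmxA mulmxDr Aw addr0 !mulmxA -(mulmxA _ A g) mulmxDl xe xAg' addr0.
  by rewrite xy DhD.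
Qed.

End Matrices.

Lemma splits_block m n (d h : 'M[R]_m) (D H : 'M[R]_n) k i c k' i' c' :
  splits d h k i c -> splits D H k' i' c' ->
  splits (block_mx d 0 0 D) (block_mx h 0 0 H)
         (fgp_sum k k') (fgp_sum i i') (fgp_sum c c').
Proof.
move=> [e1 ii cc kk] [e1' ii' cc' kk'].
have blockB p q (a : 'M[R]_p) (b : 'M[R]_q) :
  1%:M - block_mx a 0 0 b = block_mx (1%:M - a) 0 0 (1%:M - b).
  by rewrite scalar_mx_block opp_block_mx add_block_mx !subr0.
have blockM p q (a a' : 'M[R]_p) (b b' : 'M[R]_q) :
  block_mx a 0 0 b *m block_mx a' 0 0 b' = block_mx (a *m a') 0 0 (b *m b').
  by rewrite mulmx_block !(mul0mx, mulmx0, addr0, add0r).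
rewrite /splits !blockM !blockB; split.
- by rewrite e1 e1'.
- exact: (fgp_sum_iso ii ii').
- exact: (fgp_sum_iso cc cc').
- exact: (fgp_sum_iso kk kk').
Qed.

(** * The monoid V(R) as a setoid *)

Definition fgpm : Type := {P : fgp R | fgp_ok P}.
Definition fgpm_iso (a b : fgpm) : Prop := fgp_iso (sval a) (sval b).
Definition fgpm_add (a b : fgpm) : fgpm :=
  exist _ (fgp_sum (sval a) (sval b)) (fgp_sum_ok (svalP a) (svalP b)).
Definition fgpm_free n : fgpm := exist _ (fgp_free R n) (fgp_free_ok n).

Local Notation "a ~= b" := (fgpm_iso a b) (at level 70).
Local Notation "a [+] b" := (fgpm_add a b) (at level 50, left associativity).
Local Notation u := (fgpm_free 1).

Lemma fgpm_iso_refl a : a ~= a.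
Proof. exact: fgp_iso_refl (svalP a). Qed.
#[local] Hint Resolve fgpm_iso_refl : core.

(** Reflexivity and transitivity rest on idempotency, which is why [fgpm] carries it; setoid
    rewriting then allows computing as in V(R). *)
#[local] Instance fgpm_iso_equiv : Equivalence fgpm_iso.
Proof.
split=> [a | a b | a b c] //.
- exact: fgp_iso_sym.
- exact: fgp_iso_trans (svalP a) (svalP b) (svalP c).
Qed.

#[local] Instance fgpm_add_iso :
  Proper (fgpm_iso ==> fgpm_iso ==> fgpm_iso) fgpm_add.
Proof. by move=> a a' aa b b' bb; apply: fgp_sum_iso. Qed.

Lemma fgpm_addC a b : a [+] b ~= b [+] a.
Proof. exact: fgp_sumC (svalP a) (svalP b). Qed.

Lemma fgpm_addA a b c : a [+] (b [+] c) ~= a [+] b [+] c.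
Proof. exact: fgp_sumA (svalP a) (svalP b) (svalP c). Qed.

Lemma fgpm_addCA a b c : a [+] (b [+] c) ~= b [+] (a [+] c).
Proof. by rewrite fgpm_addA (fgpm_addC a b) -fgpm_addA. Qed.

Lemma fgpm_addAC a b c : a [+] b [+] c ~= a [+] c [+] b.
Proof. by rewrite -fgpm_addA (fgpm_addC b c) fgpm_addA. Qed.

Lemma fgpm_addACA a b c d : a [+] b [+] (c [+] d) ~= a [+] c [+] (b [+] d).
Proof. by rewrite -!fgpm_addA (fgpm_addCA b c). Qed.

Lemma fgpm_freeS n : fgpm_free n.+1 ~= u [+] fgpm_free n.
Proof. by rewrite /fgpm_iso /= -fgp_freeD; exact: fgp_iso_refl (fgp_free_ok _). Qed.

(** The composite R -> b + b -> R of the inclusion and projection of [u] is the identity; its two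
    components give 1 as a sum of two products. *)
Lemma generator_of_double (b t : fgpm) : b [+] b ~= u [+] t ->
  fgp_generator (sval b).
Proof.
move=> /(fgp_isoE (fgp_sum_ok (svalP b) (svalP b)) (fgp_sum_ok (svalP u) (svalP t))).
case: b t => [P Pok] [S Sok] [x [y [/= _ xP Py _ [_]]]].
move: xP Py; rewrite -(vsubmxK x) -(hsubmxK y).
rewrite mul_col_mx mul_mx_row mul_col_row => /eq_col_mx[+ _] /eq_row_mx[+ _].
move=> + + /eq_block_mx[+ _ _ _].
rewrite -(hsubmxK (usubmx x)) -(vsubmxK (lsubmx y)).
move: (lsubmx (usubmx x)) (rsubmx (usubmx x)) => x1 x2.
move: (usubmx (lsubmx y)) (dsubmx (lsubmx y)) => y1 y2.
rewrite mul_row_block mul_block_col !(mulmx0, mul0mx, addr0, add0r) mul_row_col.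
move=> /eq_row_mx[x1P x2P] /eq_col_mx[Py1 Py2] xy.
exists 2%N, (fun i => if i == ord0 then x1 else x2),
  (fun i => if i == ord0 then y1 else y2); split.
- by move=> i; case: ifP.
- by move=> i; case: ifP.
- by rewrite big_ord_recl big_ord1.
Qed.

(** * Splitting off a 1 x 1 block by refinement and cancellation *)

Section Decomposition.
Hypothesis refinement : refinement_ring R.
Hypothesis cancellation : forall A B : fgp R,
  fgp_ok A -> fgp_ok B -> fgp_generator B ->
  fgp_iso (fgp_sum (fgp_free R 2) A) (fgp_sum (fgp_free R 1) B) ->
  fgp_iso (fgp_sum (fgp_free R 1) A) B.

Lemma fgpm_refinement x1 x2 y1 y2 : x1 [+] x2 ~= y1 [+] y2 ->
  exists z11 z12 z21 z22, [/\ x1 ~= z11 [+] z12, x2 ~= z21 [+] z22,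
    y1 ~= z11 [+] z21 & y2 ~= z12 [+] z22].
Proof.
case: x1 x2 y1 y2 => [x1 x1ok] [x2 x2ok] [y1 y1ok] [y2 y2ok].
move=> /(refinement x1ok x2ok y1ok y2ok).
move=> [z11 [z12 [z21 [z22 [[o11 o12 o21 o22] H]]]]].
by exists (exist _ z11 o11), (exist _ z12 o12), (exist _ z21 o21), (exist _ z22 o22).
Qed.

Lemma fgpm_cancel (a b t : fgpm) : b [+] b ~= u [+] t ->
  u [+] (u [+] a) ~= u [+] b -> u [+] a ~= b.
Proof.
move=> bt uab; apply: (cancellation (svalP a) (svalP b) (generator_of_double bt)).
have -> : fgp_free R 2 = sval (u [+] u) by exact: (fgp_freeD 1 1).
by change (u [+] u [+] a ~= u [+] b); rewrite -fgpm_addA.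
Qed.

Lemma kernel_cokernel_step n (k i c : fgpm) :
  k [+] i ~= fgpm_free n.+2 -> c [+] i ~= fgpm_free n.+2 ->
  exists e i1 k' i' c',
    [/\ k ~= e [+] k', i ~= i1 [+] i', c ~= e [+] c', e [+] i1 ~= u
      & k' [+] i' ~= fgpm_free n.+1 /\ c' [+] i' ~= fgpm_free n.+1].
Proof.
move=> ki ci; move: (ki); rewrite (fgpm_freeS n.+1).
move=> /fgpm_refinement[k1 [k2 [i1 [i2 [hk hi hu hv]]]]].
(* Both sides equal (n+1)u; refining them isolates the part [p] of [i1] that lies in [k2], and
   leaves [q] inside [i2]. *)
have: k1 [+] fgpm_free n [+] i1 ~= k2 [+] i2.
  by rewrite fgpm_addAC -hu -hv (fgpm_freeS n).
rewrite fgpm_addC => /fgpm_refinement[p [q [k3 [i3 [hp _ hk2 hi2]]]]].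
(* p, a summand of both i1 and k2, is exchanged between the two copies: i1 is
   replaced by q, which is also a summand of i2. *)
pose k1' := k1 [+] p; pose i2' := i2 [+] p.
have uE : k1' [+] q ~= u by rewrite /k1' -fgpm_addA -hp -hu.
have vE : k3 [+] i2' ~= fgpm_free n.+1.
  by rewrite hv hk2 /i2' fgpm_addCA fgpm_addC (fgpm_addC p).
have kE : k ~= k1' [+] k3 by rewrite hk hk2 /k1' fgpm_addA.
have iE : i ~= q [+] i2' by rewrite hi hp /i2' (fgpm_addC p) -fgpm_addA (fgpm_addC p).
(* One copy of [c [+] i2'] lends its summand [q] to the other, which becomes [c [+] i], that is
   (n+2)u. Hence [c [+] i2'] is a generator. *)
have double : c [+] i2' [+] (c [+] i2') ~=
    u [+] (fgpm_free n.+1 [+] (c [+] (i3 [+] p))).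
  have e : c [+] i2' ~= q [+] (c [+] (i3 [+] p)).
    by rewrite /i2' hi2 -(fgpm_addA q) fgpm_addCA.
  rewrite (fgpm_addA u) -(fgpm_freeS n.+1) -ci iE.
  by rewrite (fgpm_addCA c q) (fgpm_addAC q) -e.
(* Adding [k1'] to [k [+] i] and [c [+] i] lets [q] and [k1'] combine into [u], so the two sides
   agree after adding [u]. The left side is (n+1)u + [k1'], so it contains the copy of [u] that the
   cancellation law requires. *)
have : k [+] i2' ~= c [+] i2'.
  have ua : u [+] (fgpm_free n [+] k1') ~= k [+] i2'.
    by rewrite fgpm_addA -(fgpm_freeS n) -vE kE fgpm_addC fgpm_addA.
  rewrite -ua; apply: (fgpm_cancel double).
  rewrite ua -uE -!fgpm_addA (fgpm_addCA q k) (fgpm_addCA q c) -iE ki.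
  by rewrite ci.
move=> /fgpm_refinement[e [f [g [h [ke i2f ce i2g]]]]].
(* The common summand [e] of [k] and [c] need not fit into one copy of [u]: only its part [e1]
   inside [k1'] is split off. The rest [f1] of [k1'] lies in [f], hence in [i2'], and can be charged
   to [i]. *)
have /fgpm_refinement[e1 [f1 [e' [f' [hk1 hk3 he hf]]]]] : k1' [+] k3 ~= e [+] f.
  by rewrite -kE.
(* Both remaining sums regroup as [k3 [+] i2'], since [k3] is [e' [+] f'] and [i2'] is both [f [+]
   h] and [g [+] h]. *)
exists e1, (q [+] f1), (e' [+] f), (f' [+] h), (e' [+] g).
split; last split.
- by rewrite ke he fgpm_addA.
- by rewrite iE i2g hf -!fgpm_addA.
- by rewrite ce he fgpm_addA.
- by rewrite -uE hk1 (fgpm_addC q) fgpm_addA.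
- by rewrite -vE fgpm_addACA -hk3 -i2g.
- by rewrite -vE fgpm_addACA -hk3 -i2f.
Qed.

Lemma diagonal_splits n (k i c : fgpm) :
  k [+] i ~= fgpm_free n -> c [+] i ~= fgpm_free n ->
  exists D h : 'M[R]_n, is_diag_mx D /\ splits D h (sval k) (sval i) (sval c).
Proof.
(* Sizes 0 and 1 are base cases, where every matrix is diagonal; the splitting step starts at size
   2. *)
elim: n k i c => [|[_|n IHn]] k i c ki ci.
- have [D [h Dh]] := splits_exists (svalP k) (svalP i) (svalP c) ki ci.
  by exists D, h; split=> //; apply/is_diag_mxP => -[].
- have [D [h Dh]] := splits_exists (svalP k) (svalP i) (svalP c) ki ci.
  by exists D, h; split=> //; apply: mx11_is_diag.
have [e [i1 [k' [i' [c' [hk hi hc eu [kv cv]]]]]]] := kernel_cokernel_step ki ci.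
(* The 1 x 1 block [d] has [e] both as kernel and as cokernel. *)
have [d [g dg]] := splits_exists (svalP e) (svalP i1) (svalP e) eu eu.
have [D [h [Ddiag Dh]]] := IHn _ _ _ kv cv.
have [DhD Di Dc Dk] := splits_block dg Dh.
have [ok1 ok2 ok3] := regular_ok DhD.
exists (block_mx d 0 0 D), (block_mx g 0 0 h); split.
  by rewrite (@is_diag_block_mx _ 1 n.+1 1 n.+1) // mx11_is_diag !eqxx.
split=> //.
- exact: (fgp_iso_trans ok1 (svalP (i1 [+] i')) (svalP i) Di (fgp_iso_sym hi)).
- exact: (fgp_iso_trans ok2 (svalP (e [+] c')) (svalP c) Dc (fgp_iso_sym hc)).
- exact: (fgp_iso_trans ok3 (svalP (e [+] k')) (svalP k) Dk (fgp_iso_sym hk)).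
Qed.

End Decomposition.

End Modules.

Theorem theorem3p4 (R : pzRingType) :
  refinement_ring R ->
  (forall A B : fgp R, fgp_ok A -> fgp_ok B -> fgp_generator B ->
     fgp_iso (fgp_sum (fgp_free R 2) A) (fgp_sum (fgp_free R 1) B) ->
     fgp_iso (fgp_sum (fgp_free R 1) A) B) ->
  forall (n : nat) (A : 'M[R]_n), regular_mx A -> diag_reducible A.
Proof.
move=> refinement cancellation n A [g AgA].
have [iok cok kok] := regular_ok AgA.
have complement (e : 'M[R]_n) : fgp_ok (FGP e) -> fgp_ok (FGP (1%:M - e)) ->
    fgp_iso (fgp_sum (FGP (1%:M - e)) (FGP e)) (fgp_free R n).
  rewrite /fgp_ok /= => ee ee'.
  apply: (@fgp_isoI _ (fgp_sum (FGP (1%:M - e)) (FGP e)) (fgp_free R n)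
    (row_mx (1%:M - e) e) (col_mx (1%:M - e) e)).
  - exact: fgp_sum_ok.
  - exact: fgp_free_ok.
  - rewrite /= mul_col_row ee ee' mulmxBl mulmxBr mul1mx mulmx1 ee.
    by rewrite subrr.
  - by rewrite mul_row_col ee ee' subrK.
have gAok : fgp_ok (FGP (g *m A)) by rewrite /fgp_ok /= -mulmxA (mulmxA A) AgA.
(* The complement of the kernel is given by [g *m A], the image by [A *m g]; identifying them lets
   the same [i] complete both [k] and [c] to R^n. *)
have gA_Ag : fgp_iso (FGP (g *m A)) (FGP (A *m g)).
  apply: (@fgp_isoI _ (FGP (g *m A)) (FGP (A *m g)) A (g *m A *m g)) => //=.
  - by rewrite -!mulmxA (mulmxA A) AgA.
  - by rewrite !mulmxA AgA.
pose k : fgpm R := exist _ _ kok; pose i : fgpm R := exist _ _ iok.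
pose c : fgpm R := exist _ _ cok.
have ki : fgpm_iso (fgpm_add k i) (fgpm_free R n).
  apply: fgp_iso_trans (complement _ gAok kok); first exact: svalP (fgpm_add k i).
  - exact: fgp_sum_ok.
  - exact: fgp_free_ok.
  - exact: fgp_sum_iso (fgp_iso_refl kok) (fgp_iso_sym gA_Ag).
have ci : fgpm_iso (fgpm_add c i) (fgpm_free R n) := complement _ iok cok.
have [D [h [Ddiag [DhD Di Dc Dk]]]] :=
  diagonal_splits refinement cancellation ki ci.
have [P [Q [Pinv Qinv PAQ]]] := regular_equivalent AgA DhD
  (fgp_iso_sym Di) (fgp_iso_sym Dc) (fgp_iso_sym Dk).
by exists P, Q; rewrite PAQ.
Qed.
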